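(* Let $n\ge 1$ and let $P=J([2]\times[n-1])$ (the distributive lattice of order ideals of $[2]\times[n-1]$, viewed as a poset under inclusion). There is a bijection $\Phi$ from $J(P)$ to the set of binary words of length $2n$ of the form $w\,(1-w)$, where $w=w_1\cdots w_n$ is any binary word of length $n$ and $1-w=(1-w_1)\cdots(1-w_n)$, such that $\Phi\circ\mathrm{row}=\mathrm{rot}\circ\Phi$, where $\mathrm{rot}(u_1u_2\cdots u_{2n})=u_2\cdots u_{2n}u_1$.
   Context: $[m]$ denotes the $m$-element chain, $[2]\times[n-1]$ the product poset with componentwise order, and $J(Q)$ the set of order ideals of a poset $Q$. Rowmotion on $J(Q)$: $\mathrm{row}(I)$ is the order ideal generated by the minimal elements of $Q\setminus I$. (The set of words of the form $w(1-w)$ is closed under $\mathrm{rot}$.) *)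

(* Defs.v *)
From HB Require Import structures.
From mathcomp Require Import all_boot all_order.

Set Implicit Arguments.
Unset Strict Implicit.
Unset Printing Implicit Defensive.

Import Order.TTheory.
Local Open Scope order_scope.

Fact ideal_display : Order.disp_t. Proof. exact: Order.Disp tt tt. Qed.

Section OrderIdeals.
Variables (d : Order.disp_t) (Q : finPOrderType d).
Implicit Types (A I : {set Q}).

Definition is_order_ideal I : bool :=
  [forall x, forall y, (x <= y) ==> (y \in I) ==> (x \in I)].

Record order_ideal := OrderIdeal {
  ideal_set :> {set Q};
  ideal_setP : is_order_ideal ideal_set }.

HB.instance Definition _ := [isSub for ideal_set].
HB.instance Definition _ := [Finite of order_ideal by <:].

Definition ideal_le (I J : order_ideal) : bool := ideal_set I \subset ideal_set J.

Lemma ideal_le_refl : reflexive ideal_le.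
Proof. by move=> I; apply: subxx. Qed.

Lemma ideal_le_anti : antisymmetric ideal_le.
Proof. by move=> I J IJ; apply/val_inj/eqP; rewrite eqEsubset. Qed.

Lemma ideal_le_trans : transitive ideal_le.
Proof. by move=> J I K; apply: subset_trans. Qed.

HB.instance Definition _ := Order.Le_isPOrder.Build ideal_display
  order_ideal ideal_le_refl ideal_le_anti ideal_le_trans.

Definition minimal_elements A : {set Q} :=
  [set x in A | [forall y in A, (y <= x) ==> (y == x)]].

Definition down_closure A : {set Q} := [set x | [exists y in A, x <= y]].

Lemma down_closure_ideal A : is_order_ideal (down_closure A).
Proof.
apply/forallP=> x; apply/forallP=> y; apply/implyP=> xy; apply/implyP.
rewrite !inE => /exists_inP[z zA yz].
by apply/exists_inP; exists z => //; apply: le_trans yz.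
Qed.

Definition rowmotion (I : order_ideal) : order_ideal :=
  OrderIdeal (down_closure_ideal (minimal_elements (~: ideal_set I))).

End OrderIdeals.

Arguments order_ideal {d} Q.

Notation "''J' ( Q )" := (order_ideal Q) (at level 8, format "''J' ( Q )").

Section Words.
Variable n : nat.

Definition is_w_negw (u : (2 * n)%N.-tuple bool) : bool :=
  [exists w : n.-tuple bool, tval u == w ++ map negb w].

Record w_negw_word := WNegWWord {
  word_val :> (2 * n)%N.-tuple bool;
  word_valP : is_w_negw word_val }.

HB.instance Definition _ := [isSub for word_val].
HB.instance Definition _ := [Finite of w_negw_word by <:].

Lemma is_w_negw_rot u : is_w_negw u -> is_w_negw [tuple of rot 1 u].
Proof.
case/existsP=> -[w szw] /eqP /= uE; apply/existsP.
case: w szw uE => [|b w] szw uE.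
  by exists (Tuple szw); rewrite /= uE.
have szw' : size (rcons w (~~ b)) == n by rewrite size_rcons.
exists (Tuple szw'); rewrite /= uE /= rot1_cons.
by rewrite map_rcons negbK rcons_cat /= cat_rcons.
Qed.

(* [rot 1] moves the first letter to the end: u_1 u_2 ... |-> u_2 ... u_1 *)
Definition word_rot (u : w_negw_word) : w_negw_word :=
  WNegWWord (is_w_negw_rot (word_valP u)).

End Words.

(* Main.v *)
(** Writing [(a, b)], [b <= a < n], for the two row lengths of an element of
    [J([2] x [n-1])], attach to a binary sequence [x_0 ... x_{n-1}] with partial
    sums [c] the ideal [{(a, b) : c a + c b < c n}].  Its maximal elements are
    the [(a, b)] with [x_a = x_b = 1] and [c a + c b + 1 = c n], so [x] is the
    indicator of the coordinates that occur in them (a symmetric Stanley-Thomas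
    word).  If [u] is [x] shifted by one step, with the letter [x_0] that drops
    out returning negated at the end, then the ideal of [u] is
    [{(a, b) : c (a+1) + c (b+1) <= c n}], and the minimal elements of its
    complement are the same [(a, b)]; hence rowmotion sends the ideal of [u] to
    that of [x].  There are no other ideals because an ideal is determined by
    the set of lengths of its rows [b = const], a strict partition with parts at
    most [n]. *)

Require Import Defs.
From mathcomp Require Import all_boot all_order.
From mathcomp Require Import zify.

Set Implicit Arguments.
Unset Strict Implicit.
Unset Printing Implicit Defensive.

Import Order.TTheory.

(** * Partial sums of binary sequences *)

Section PartialSums.
Implicit Types (x u : nat -> bool) (i j k n v : nat).

Definition psum x k := \sum_(i < k) x i.

Lemma psum0 x : psum x 0 = 0.
Proof. by rewrite /psum big_ord0. Qed.

Lemma psumS x k : psum x k.+1 = psum x k + x k.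
Proof. by rewrite /psum big_ord_recr. Qed.

Lemma psum_le x i j : i <= j -> psum x i <= psum x j.
Proof.
move=> /subnK <-; elim: (j - i) => // k IHk.
by rewrite addSn psumS (leq_trans IHk) // leq_addr.
Qed.

(** Partial sums grow by at most 1 per step, so no value below the total is skipped. *)
Lemma psum_jump x n v :
  v < psum x n -> exists j, [/\ j < n, x j & psum x j = v].
Proof.
elim: n => [|n IHn]; rewrite ?psum0 // psumS => v_lt.
have [/IHn[j [jn xj cj]]|ge_v] := ltnP v (psum x n).
  by exists j; rewrite ltnS ltnW.
by exists n; case: (x n) v_lt => /= v_lt; split => //; lia.
Qed.

Lemma psum_shift x u n k : (forall i, i.+1 < n -> u i = x i.+1) -> k < n ->
  psum x k.+1 = x 0 + psum u k.
Proof.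
move=> ux; elim: k => [|k IHk] kn; first by rewrite psumS !psum0 addnC.
by rewrite psumS IHk ?(ltnW kn) // psumS ux // addnA.
Qed.

End PartialSums.

(** * Order ideals of an abstract staircase with coordinates [b <= a < n] *)

Section Staircase.
Variables (d : Order.disp_t) (P : finPOrderType d) (n : nat).
Variables (alpha beta : P -> nat).
Hypothesis le_coord : forall p q : P,
  (p <= q)%O = (alpha p <= alpha q) && (beta p <= beta q).
Hypothesis coord_le : forall p, beta p <= alpha p.
Hypothesis coord_lt : forall p, alpha p < n.
Hypothesis coord_surj : forall a b, b <= a -> a < n ->
  exists2 p, alpha p = a & beta p = b.

Implicit Types (x u : nat -> bool) (I : 'J(P)) (p q : P).

Lemma coord_inj p q : alpha p = alpha q -> beta p = beta q -> p = q.
Proof. by move=> ea eb; apply/le_anti; rewrite !le_coord ea eb !leqnn. Qed.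

Lemma ideal_down I p q : (p <= q)%O -> q \in ideal_set I -> p \in ideal_set I.
Proof.
by have /forallP/(_ p)/forallP/(_ q)/implyP H := ideal_setP I => /H/implyP.
Qed.

Definition seq_ideal_set x : {set P} :=
  [set p | psum x (alpha p) + psum x (beta p) < psum x n].

Lemma seq_ideal_setP x : is_order_ideal (seq_ideal_set x).
Proof.
apply/forallP=> p; apply/forallP=> q; apply/implyP; rewrite le_coord !inE.
case/andP=> /(psum_le x) ca /(psum_le x) cb; apply/implyP; lia.
Qed.

Definition seq_ideal x : 'J(P) := OrderIdeal (seq_ideal_setP x).

Definition maximal_in (A : {set P}) p :=
  p \in A /\ forall q, q \in A -> (p <= q)%O -> q = p.

Definition turning x p :=
  [/\ x (alpha p), x (beta p)
    & (psum x (alpha p) + psum x (beta p)).+1 = psum x n].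

Lemma maximal_seq_ideal x p : maximal_in (seq_ideal x) p <-> turning x p.
Proof.
split=> [[pI pmax]|[xa xb cn]]; last first.
  split=> [|q]; first by rewrite inE -cn.
  rewrite inE le_coord => qI /andP[].
  have := psumS x (alpha p); have := psumS x (beta p); rewrite xa xb => cbS caS.
  rewrite leq_eqVlt => /orP[/eqP ea|/(psum_le x) lt_a].
    rewrite leq_eqVlt => /orP[/eqP eb|/(psum_le x) lt_b].
      exact: coord_inj.
    by move: qI; rewrite -ea; lia.
  by move/(psum_le x); lia.
move: pI; rewrite inE => pI.
(* The neighbour [(a + 1, b)] lies outside the ideal. If [a + 1 = n] there is no such element, but
   then [psum x n] is itself a summand. *)
have stepa : psum x n <= psum x (alpha p).+1 + psum x (beta p).
  have [lt_n|ge_n] := ltnP (alpha p).+1 n; last first.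
    have -> : n = (alpha p).+1 by have := coord_lt p; lia.
    exact: leq_addr.
  have [|q qa qb] := @coord_surj (alpha p).+1 (beta p) _ lt_n.
    by rewrite ltnW // ltnS.
  rewrite leqNgt; apply/negP => lt_c.
  have qI : q \in seq_ideal_set x by rewrite inE qa qb.
  have pq : (p <= q)%O by rewrite le_coord qa qb leqnSn leqnn.
  by have := congr1 alpha (pmax q qI pq); lia.
have xa : x (alpha p) by move: stepa pI; rewrite psumS; case: (x _) => //=; lia.
have cn : (psum x (alpha p) + psum x (beta p)).+1 = psum x n.
  by move: stepa pI; rewrite psumS; case: (x _) => /=; lia.
split=> //.
(* On the diagonal this letter is [x (alpha p)]. Off it, a letter 0 would put [(a, b + 1)] into the
   ideal. *)
have [lt_ba|ge_ba] := ltnP (beta p) (alpha p); last first.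
  by have -> : beta p = alpha p by have := coord_le p; lia.
have [q qa qb] := @coord_surj (alpha p) (beta p).+1 lt_ba (coord_lt p).
case xb: (x (beta p)) => //.
have qI : q \in seq_ideal_set x by rewrite inE qa qb psumS xb addn0.
have pq : (p <= q)%O by rewrite le_coord qa qb leqnSn leqnn.
by have := congr1 beta (pmax q qI pq); lia.
Qed.

Lemma below_maximal (A : {set P}) p :
  p \in A -> exists2 q, (p <= q)%O & maximal_in A q.
Proof.
move=> pA; pose above q := (q \in A) && (p <= q)%O.
have ap : above p by rewrite /above pA lexx.
case: (arg_maxnP (fun q => alpha q + beta q) ap) => q /andP[qA pq] qmax.
exists q => //; split=> // r rA qr.
have /qmax : above r by rewrite /above rA (le_trans pq qr).
move: qr; rewrite le_coord => /andP[] ? ? ?; apply: coord_inj; lia.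
Qed.

(** Every 1 of [x] is a coordinate of a maximal element: the k-th 1 from the left is paired with the
    k-th 1 from the right. *)
Lemma seq_ideal_eq x u : seq_ideal x = seq_ideal u ->
  forall i, i < n -> x i -> u i.
Proof.
move=> exu i lt_in xi.
have ci := psumS x i; rewrite xi in ci.
have [|j [lt_jn xj cj]] := @psum_jump x n (psum x n - (psum x i).+1).
  have := psum_le x lt_in; lia.
have cij : (psum x i + psum x j).+1 = psum x n by have := psum_le x lt_in; lia.
have [le_ji|le_ij] := leqP j i.
  have [p pa pb] := coord_surj le_ji lt_in.
  have : turning x p by split; rewrite ?pa ?pb.
  by move/maximal_seq_ideal; rewrite exu => /maximal_seq_ideal[]; rewrite pa.
have [p pa pb] := coord_surj (ltnW le_ij) lt_jn.
have : turning x p by split; rewrite ?pa ?pb // addnC.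
by move/maximal_seq_ideal; rewrite exu => /maximal_seq_ideal[_]; rewrite pb.
Qed.

(** * Rowmotion as a shift with negation *)

Lemma mem_shift_ideal x u p :
  (forall i, i.+1 < n -> u i = x i.+1) -> u n.-1 = ~~ x 0 ->
  (p \in ideal_set (seq_ideal u)) =
  (psum x (alpha p).+1 + psum x (beta p).+1 <= psum x n).
Proof.
move=> ux un; rewrite inE.
have lt_an := coord_lt p; have lt_bn := leq_ltn_trans (coord_le p) lt_an.
rewrite (psum_shift ux lt_an) (psum_shift ux lt_bn).
have n_gt0 : n.-1 < n by lia.
(* The total of [u] is [psum x n + 1 - 2 * x 0]; both copies of [x 0] cancel and [<] turns into
   [<=]. *)
have := psum_shift ux n_gt0; have := psumS u n.-1.
by rewrite prednK ?un; case: (x 0) => /=; lia.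
Qed.

(** Membership is enough for one inclusion, since the ideal of [x] is closed downwards. *)
Lemma minimal_compl_shift x u p :
  (forall i, i.+1 < n -> u i = x i.+1) -> u n.-1 = ~~ x 0 ->
  p \in minimal_elements (~: ideal_set (seq_ideal u)) ->
  p \in ideal_set (seq_ideal x).
Proof.
move=> ux un; rewrite inE in_setC (mem_shift_ideal _ ux un) -ltnNge.
case/andP=> pI /forall_inP pmin.
have down q : (q <= p)%O -> q != p ->
    psum x (alpha q).+1 + psum x (beta q).+1 <= psum x n.
  move=> qp neq; rewrite leqNgt; apply/negP => qI.
  have /pmin : q \in ~: ideal_set (seq_ideal u).
    by rewrite in_setC (mem_shift_ideal _ ux un) -ltnNge.
  by rewrite qp (negPf neq).
have lt_an := coord_lt p; have le_ba := coord_le p.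
have neq_a q : alpha q < alpha p -> q != p by apply: contraTneq => ->; lia.
have neq_b q : beta q < beta p -> q != p by apply: contraTneq => ->; lia.
(* This comes from the lower neighbour [(a, b - 1)], or from monotonicity if [b = 0]. With [pI] it
   forces [x (beta p)] to be 1. *)
have stepb : psum x (alpha p).+1 + psum x (beta p) <= psum x n.
  case eb: (beta p) => [|b]; first by rewrite psum0 addn0 psum_le.
  have [|//|q qa qb] := @coord_surj (alpha p) b; first by lia.
  have := down q; rewrite qa qb; apply; last by apply: neq_b; lia.
  by rewrite le_coord; lia.
rewrite inE; move: pI stepb; rewrite !psumS.
(* On the diagonal [stepb] and [pI] suffice; off it the lower neighbour [(a - 1, b)] gives the
   bound. *)
have [lt_ba|ge_ba] := ltnP (beta p) (alpha p); last first.
  have -> : beta p = alpha p by lia.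
  by case: (x _) => /=; lia.
have [||q qa qb] := @coord_surj (alpha p).-1 (beta p); [by lia..|].
have := down q; rewrite qa qb prednK; last by lia.
have -> : (q <= p)%O by rewrite le_coord; lia.
rewrite neq_a ?psumS; last by lia.
by move/(_ isT isT); case: (x (beta p)) => /=; lia.
Qed.

(** At [p] the sum is [psum x n + 1], and lowering either coordinate loses the letter 1 there. *)
Lemma turning_minimal_compl x u p :
  (forall i, i.+1 < n -> u i = x i.+1) -> u n.-1 = ~~ x 0 ->
  turning x p -> p \in minimal_elements (~: ideal_set (seq_ideal u)).
Proof.
move=> ux un [xa xb cn].
have caS := psumS x (alpha p); have cbS := psumS x (beta p).
rewrite xa in caS; rewrite xb in cbS.
rewrite inE in_setC (mem_shift_ideal _ ux un) -ltnNge; apply/andP; split.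
  by lia.
apply/forall_inP => q; rewrite in_setC (mem_shift_ideal _ ux un) -ltnNge => qI.
apply/implyP; rewrite le_coord => /andP[].
rewrite leq_eqVlt => /orP[/eqP ea|/(psum_le x) lt_a]; last first.
  by rewrite -ltnS => /(psum_le x); lia.
rewrite leq_eqVlt => /orP[/eqP eb|/(psum_le x) lt_b].
  by apply/eqP/coord_inj.
by move: qI; rewrite ea; lia.
Qed.

Lemma rowmotion_seq_ideal x u :
  (forall i, i.+1 < n -> u i = x i.+1) -> u n.-1 = ~~ x 0 ->
  rowmotion (seq_ideal u) = seq_ideal x.
Proof.
move=> ux un; apply/val_inj/setP => p; apply/idP/idP.
  rewrite [p \in _]inE => /exists_inP[q /(minimal_compl_shift ux un) qI pq].
  exact: ideal_down pq qI.
case/below_maximal => q pq qmax; rewrite inE; apply/exists_inP; exists q => //.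
by apply: (turning_minimal_compl ux un); apply/maximal_seq_ideal.
Qed.

(** * Recovering an ideal from its set of row lengths *)

Definition mem_coord I a b :=
  [exists p in ideal_set I, (alpha p == a) && (beta p == b)].

Lemma mem_coordE I p : mem_coord I (alpha p) (beta p) = (p \in ideal_set I).
Proof.
apply/exists_inP/idP => [[q qI /andP[/eqP ea /eqP eb]]|pI].
  by rewrite -(coord_inj ea eb).
by exists p; rewrite ?eqxx.
Qed.

Lemma mem_coord_lt I a b : mem_coord I a b -> a < n.
Proof. by case/exists_inP => p _ /andP[/eqP <- _]. Qed.

Lemma mem_coord_down I a b a' b' : a' <= a -> b' <= b -> b' <= a' ->
  mem_coord I a b -> mem_coord I a' b'.
Proof.
move=> le_a le_b le_ba' /exists_inP[p pI /andP[/eqP ea /eqP eb]].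
have lt_an : a' < n by have := coord_lt p; lia.
have [q qa qb] := coord_surj le_ba' lt_an.
rewrite -qa -qb mem_coordE; apply: ideal_down pI.
by rewrite le_coord ea eb qa qb le_a.
Qed.

(* [part I k] says that some row [{(a, b) \in I}] with [b] fixed has length
   [k + 1]. *)
Definition part I k :=
  [exists b : 'I_n, mem_coord I (b + k) b && ~~ mem_coord I (b + k).+1 b].

(** If [(b + k, b)] were in [I] only, row [b] of [I] would end there, so some row [b'] of [J] ends
    on the same diagonal, with [b' < b]. Then [(b' + k + 1, b')] lies below [(b + k, b)], hence in
    [I], hence in [J], a contradiction. *)
Lemma part_sub I J k : (forall i, part I i = part J i) ->
  (forall b, mem_coord I (b + k).+1 b = mem_coord J (b + k).+1 b) ->
  forall b, mem_coord I (b + k) b -> mem_coord J (b + k) b.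
Proof.
move=> eqp eqIJ b Ib; case Jb: (mem_coord J (b + k) b) => //.
have nIb : ~~ mem_coord I (b + k).+1 b.
  apply/negP; rewrite eqIJ => Jb1; move: Jb.
  by rewrite (mem_coord_down _ _ _ Jb1) //; lia.
have lt_bn : b < n by have := mem_coord_lt Ib; lia.
have : part I k by apply/existsP; exists (Ordinal lt_bn); rewrite /= Ib.
rewrite eqp => /existsP[b' /andP[Jb' /negP[]]].
have lt_b' : b' < b.
  rewrite ltnNge; apply/negP => le_b; move: Jb.
  by rewrite (mem_coord_down _ _ _ Jb') //; lia.
by rewrite -eqIJ; apply: mem_coord_down Ib; lia.
Qed.

Lemma part_inj I J : (forall k, part I k = part J k) -> I = J.
Proof.
(* Compare the diagonals [a - b = n - k] from the outermost inwards; the one at [n] misses the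
   staircase. *)
move=> eqp; suff diag k : k <= n ->
    forall b, mem_coord I (b + (n - k)) b = mem_coord J (b + (n - k)) b.
  apply/val_inj/setP => p; rewrite /= -!mem_coordE.
  have le_ba := coord_le p; have lt_an := coord_lt p.
  have := diag (n - (alpha p - beta p)) (leq_subr _ _) (beta p).
  by rewrite subKn ?subnKC //; lia.
elim: k => [|k IHk] le_kn b.
  by apply/idP/idP => /mem_coord_lt; lia.
have {}IHk c : mem_coord I (c + (n - k.+1)).+1 c =
               mem_coord J (c + (n - k.+1)).+1 c.
  by rewrite -addnS -subSn // subSS IHk // ltnW.
by apply/idP/idP; apply: part_sub.
Qed.

End Staircase.

(** * Words [w (1 - w)] and their rotation *)

Section Words.
Variable n : nat.

(* The letters of the first half [w], read from right to left, so that rotating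
   the word to the left shifts this sequence to the right. *)
Definition word_seq (u : w_negw_word n) (i : nat) : bool :=
  nth false u (n.-1 - i).

Lemma word_valE (u : w_negw_word n) :
  exists2 w : n.-tuple bool, tval u = w ++ map negb w &
    forall i, i < n -> nth false u i = nth false w i.
Proof.
have /existsP[w /eqP uE] := word_valP u; exists w => // i lt_in.
by rewrite uE nth_cat size_tuple lt_in.
Qed.

Lemma word_seq_inj (u v : w_negw_word n) :
  (forall i, i < n -> word_seq u i = word_seq v i) -> u = v.
Proof.
move=> euv; apply/val_inj/val_inj => /=.
have [w1 uE u1] := word_valE u; have [w2 vE v2] := word_valE v.
suff e12 : w1 = w2 by rewrite uE vE e12.
apply/val_inj/(@eq_from_nth _ false); rewrite ?size_tuple // => i lt_in.
have := euv (n.-1 - i); rewrite /word_seq subKn; last by lia.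
by rewrite u1 // v2 // => -> //; lia.
Qed.

Lemma word_seq_rotS (u : w_negw_word n) i : i.+1 < n ->
  word_seq u i = word_seq (word_rot u) i.+1.
Proof.
move=> lt_in; rewrite /word_seq /= /rot nth_cat nth_drop size_drop size_tuple.
by rewrite ifT; [congr nth|]; lia.
Qed.

Lemma word_seq_rot0 (u : w_negw_word n) : 0 < n ->
  word_seq u n.-1 = ~~ word_seq (word_rot u) 0.
Proof.
move=> n_gt0; rewrite /word_seq /= subnn subn0 /rot nth_cat nth_drop size_drop.
rewrite size_tuple ifT; last by lia.
(* Index [n] opens the second half, so it carries the negated first letter. *)
have -> : 1 + n.-1 = n by lia.
have [w -> _] := word_valE u.
rewrite !nth_cat size_tuple n_gt0 ltnn subnn (nth_map false) ?size_tuple //.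
by rewrite negbK.
Qed.

Lemma w_negw_of_bits (w : n.-tuple bool) :
  exists u : w_negw_word n, tval u = w ++ map negb w.
Proof.
have sz : size (w ++ map negb w) == 2 * n.
  by rewrite size_cat size_map size_tuple mul2n addnn.
have wP : is_w_negw (Tuple sz) by apply/existsP; exists w.
by exists (WNegWWord wP).
Qed.

Lemma card_w_negw : #|{: n.-tuple bool}| <= #|{: w_negw_word n}|.
Proof.
have ex (w : n.-tuple bool) :
    exists u : w_negw_word n, tval u == w ++ map negb w.
  by have [u uE] := w_negw_of_bits w; exists u; apply/eqP.
apply: (@leq_card _ _ (fun w => xchoose (ex w))) => w1 w2 e12.
have := xchooseP (ex w1); rewrite e12 (eqP (xchooseP (ex w2))).
by rewrite eqseq_cat ?size_tuple // => /andP[/eqP/val_inj].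
Qed.

End Words.

(** * Elements of [J([2] x [m])] as pairs of row lengths *)

Section RowLengths.
Variable m : nat.
Implicit Types (p q : 'J('I_2 *p 'I_m)) (r : 'I_2) (j : 'I_m).

Definition rowlen r p := #|[set j | ((r, j) : 'I_2 *p 'I_m) \in ideal_set p]|.

Lemma card_ord_lt k : k <= m -> #|[set j : 'I_m | j < k]| = k.
Proof.
move=> le_km; rewrite cardsE -sum1_card.
by rewrite (big_ord_narrow le_km) sum1_card card_ord.
Qed.

(** A row of an ideal is an initial segment; it is compared with those of sizes [j + 1] and [j]. *)
Lemma mem_rowlen r j p :
  (((r, j) : 'I_2 *p 'I_m) \in ideal_set p) = (j < rowlen r p).
Proof.
have down (i : 'I_m) (k : 'I_m) : i <= k ->
    ((r, k) : 'I_2 *p 'I_m) \in ideal_set p ->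
    ((r, i) : 'I_2 *p 'I_m) \in ideal_set p.
  by move=> le_ik; apply: ideal_down; rewrite Order.ProdOrder.leEprod /= lexx.
apply/idP/idP => [jp|].
  rewrite -{1}(@card_ord_lt j.+1) //; apply: subset_leq_card.
  by apply/subsetP => i; rewrite !inE ltnS => /down; apply.
apply: contraTT => jp; rewrite -leqNgt -(@card_ord_lt j) ?(ltnW (ltn_ord j)) //.
apply: subset_leq_card; apply/subsetP => i; rewrite !inE => ip.
by rewrite ltnNge; apply: contra jp => /down; apply.
Qed.

Lemma rowlen_max r p : rowlen r p <= m.
Proof. by rewrite (leq_trans (max_card _)) ?card_ord. Qed.

Lemma ord2E r : r = ord0 \/ r = ord_max.
Proof. by case: r => [[|[|//]] ?]; [left|right]; apply/val_inj. Qed.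

Lemma le_rowlen p q : (p <= q)%O =
  (rowlen ord0 p <= rowlen ord0 q) && (rowlen ord_max p <= rowlen ord_max q).
Proof.
apply/subsetP/andP => [pq|[le0 le1] [r j]].
  by split; apply: subset_leq_card; apply/subsetP => j; rewrite !inE => /pq.
by rewrite !mem_rowlen; case: (ord2E r) => -> /leq_trans; apply.
Qed.

Lemma rowlen_anti p : rowlen ord_max p <= rowlen ord0 p.
Proof.
apply: subset_leq_card; apply/subsetP => j; rewrite !inE.
by apply: ideal_down; rewrite Order.ProdOrder.leEprod /= lexx.
Qed.

Lemma rowlen_surj a b : b <= a -> a <= m ->
  exists2 p, rowlen ord0 p = a & rowlen ord_max p = b.
Proof.
move=> le_ba le_am; pose len (r : 'I_2) := if r == ord0 then a else b.
pose A : {set 'I_2 *p 'I_m} := [set x | (x.2 : 'I_m) < len x.1].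
have AP : is_order_ideal A.
  apply/forallP=> -[r j]; apply/forallP=> -[s k]; apply/implyP.
  rewrite Order.ProdOrder.leEprod /= !inE /= => /andP[rs jk]; apply/implyP.
  move/(leq_ltn_trans jk)/leq_trans; apply; rewrite /len.
  by case: (ord2E r) rs => ->; case: (ord2E s) => ->.
exists (OrderIdeal AP); rewrite /rowlen.
  rewrite -[RHS](card_ord_lt le_am); apply: eq_card => j.
  by rewrite !inE.
rewrite -[RHS](card_ord_lt (leq_trans le_ba le_am)); apply: eq_card => j.
by rewrite !inE.
Qed.

End RowLengths.

Theorem theorem6p2 (n : nat) (hn : (1 <= n)%N) :
  exists Phi : 'J('J('I_2 *p 'I_(n - 1))) -> w_negw_word n,
    bijective Phi /\ forall I, Phi (rowmotion I) = word_rot (Phi I).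
Proof.
pose alpha := @rowlen (n - 1) ord0; pose beta := @rowlen (n - 1) ord_max.
have le_c : forall p q, (p <= q)%O = (alpha p <= alpha q) && (beta p <= beta q).
  exact: le_rowlen.
have c_le : forall p, beta p <= alpha p by exact: rowlen_anti.
have c_lt p : alpha p < n.
  by have := rowlen_max ord0 p; rewrite -/(alpha p); lia.
have c_surj a b : b <= a -> a < n -> exists2 p, alpha p = a & beta p = b.
  by move=> le_ba lt_an; apply: rowlen_surj => //; lia.
pose Psi (u : w_negw_word n) := seq_ideal n le_c (word_seq u).
have Psi_inj : injective Psi.
  move=> u v euv; apply: word_seq_inj => i lt_in; apply/idP/idP.
    exact: (seq_ideal_eq c_le c_lt c_surj euv).
  exact: (seq_ideal_eq c_le c_lt c_surj (esym euv)).
(* The [n] bits telling which row lengths occur determine the ideal, so counting makes the injection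
   [Psi] bijective. *)
have Psi_card : #|{: 'J('J('I_2 *p 'I_(n - 1)))}| <= #|{: w_negw_word n}|.
  apply: leq_trans (card_w_negw n).
  apply: (@leq_card _ _ (fun I => [tuple part n alpha beta I i | i < n])).
  move=> I J eIJ; apply: (part_inj le_c c_le c_lt c_surj) => k.
  have [lt_kn|le_nk] := ltnP k n.
    have := congr1 (fun t => tnth t (Ordinal lt_kn)) eIJ.
    by rewrite !tnth_mktuple.
  by apply/existsP/existsP => -[b /andP[/(mem_coord_lt c_lt)]]; lia.
have [Phi PsiK PhiK] := inj_card_bij Psi_inj Psi_card.
exists Phi; split; first by exists Psi.
(* After applying [Psi], the word of [I] plays [u] and its rotation plays [x]. *)
move=> I; apply: (can_inj PsiK); rewrite PhiK -{1}(PhiK I).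
apply: rowmotion_seq_ideal => // [i|]; first exact: word_seq_rotS.
exact: word_seq_rot0.
Qed.
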